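(* Let $q$ be a power of an odd prime. For every integer $d \geq 4$, every vector in $\mathbb{F}_q^d$ is the sum of $2$ unit vectors.
   Context: For $x \in \mathbb{F}_q^d$, $\|x\| = x_1^2+\dots+x_d^2 \in \mathbb{F}_q$, and $x$ is a unit vector if and only if $\|x\| = 1$. ''$x$ is the sum of $2$ unit vectors'' means $x = u_1+u_2$ with $u_1,u_2\in\mathbb{F}_q^d$ unit vectors (possibly equal). *)

(* Defs.v *)
From HB Require Import structures.
From mathcomp Require Import all_boot all_order all_algebra.
Set Implicit Arguments. Unset Strict Implicit. Unset Printing Implicit Defensive.
Import GRing.Theory.
Local Open Scope ring_scope.

(* The "norm" is the sum of squares, without square root, valued in F. *)
Definition sqnorm (F : finFieldType) (d : nat) (x : 'rV[F]_d) : F :=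
  \sum_(i < d) x ord0 i ^+ 2.

Definition unit_vector (F : finFieldType) (d : nat) (x : 'rV[F]_d) : Prop :=
  sqnorm x = 1.

Definition sum_of_two_unit_vectors (F : finFieldType) (d : nat)
    (x : 'rV[F]_d) : Prop :=
  exists u1 u2 : 'rV[F]_d,
    [/\ unit_vector u1, unit_vector u2 & x = u1 + u2].

(* Main.v *)
Require Import Defs.
From HB Require Import structures.
From mathcomp Require Import all_boot all_order all_algebra.
From mathcomp Require Import finfield ring.
Set Implicit Arguments. Unset Strict Implicit. Unset Printing Implicit Defensive.
Import GRing.Theory.
Local Open Scope ring_scope.

(** Looking for the two summands in the symmetric form [x / 2 + w] and
    [x / 2 - w], both are unit vectors as soon as [w] is orthogonal to [x] and
    has norm [1 - |x| / 4].  So it suffices that the orthogonal complement of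
    every vector takes every value of the norm, and for this one may work with
    the first four coordinates only ([orthogonal_norm_surj4],
    [orthogonal_norm_surj]).

    In dimension four the complement of [(a, b, c, e)] contains two mutually
    orthogonal vectors of nonzero norms [alpha] and [beta], whose combinations
    have norm [alpha * s ^+ 2 + beta * t ^+ 2]; over a finite field of odd order
    such a form takes every value, by a pigeonhole argument
    ([diag_binary_form_surj]).  If [(a, b, c, e)] has nonzero norm, the two
    vectors are its quaternion multiples by [i] and [j].  If it has norm zero,
    they come from splitting the coordinates into two pairs of nonzero norm and
    rotating each pair by a right angle; when no splitting works, the vector
    vanishes and any two basis vectors do. *)

(** Every nonempty fibre of [f] lies in a pair [{s, - s}], so [f] is at most
    two-to-one. *)
Lemma card_image_even_fun (F : finFieldType) (f : F -> F) :
  (forall s s', f s = f s' -> s = s' \/ s = - s') ->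
  (#|F| <= #|f @: [set: F]| * 2)%N.
Proof.
move=> f_inj; rewrite -cardsT -sum1_card (partition_big_imset f) /=.
rewrite -sum_nat_const; apply: leq_sum => _ /imsetP[s _ ->].
rewrite sum1_card; apply: (@leq_trans #|[set s; - s]|); last first.
  by rewrite cards2; case: (_ != _).
apply: subset_leq_card; apply/subsetP => s'.
rewrite unfold_in !inE /= => /eqP/f_inj[] ->; by rewrite eqxx ?orbT.
Qed.

(** The sets of values of [alpha * s ^+ 2] and of [r - beta * t ^+ 2] each
    contain at least half of the field, hence more than half since the order is
    odd: they meet. *)
Lemma diag_binary_form_surj (F : finFieldType) (alpha beta r : F) :
  odd #|F| -> alpha != 0 -> beta != 0 ->
  exists s t, alpha * s ^+ 2 + beta * t ^+ 2 = r.
Proof.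
move=> oddF alpha0 beta0.
pose f s := alpha * s ^+ 2; pose g t := r - beta * t ^+ 2.
have sqr_inj (s s' : F) : s ^+ 2 = s' ^+ 2 -> s = s' \/ s = - s'.
  by move/eqP; rewrite eqf_sqr => /orP[]/eqP; [left|right].
have card_f : (#|F| <= #|f @: [set: F]| * 2)%N.
  by apply: card_image_even_fun => s s' /(mulfI alpha0)/sqr_inj.
have card_g : (#|F| <= #|g @: [set: F]| * 2)%N.
  apply: card_image_even_fun => s s' /addrI/oppr_inj.
  by move/(mulfI beta0)/sqr_inj.
have odd_lt n : (#|F| <= n * 2)%N -> (#|F| < n * 2)%N.
  rewrite leq_eqVlt => /orP[/eqP eqF|//].
  by move: oddF; rewrite eqF muln2 odd_double.
have cardI := cardsUI (f @: [set: F]) (g @: [set: F]).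
have [I0|[y]] := set_0Vmem (f @: [set: F] :&: g @: [set: F]).
  have := leq_add (odd_lt _ card_f) (odd_lt _ card_g).
  rewrite -mulnDl -cardI I0 cards0 addn0 => lt2.
  have := leq_trans lt2 (leq_mul (max_card _) (leqnn 2)).
  by rewrite muln2 -addnn addnS addSn ltnNge leqnSn.
rewrite inE => /andP[/imsetP[s _ ->] /imsetP[t _ eq_fg]].
by exists s, t; rewrite -/(f s) eq_fg subrK.
Qed.

(** It suffices to find two orthogonal vectors of nonzero norm in the
    complement of [(a, b, c, e)].  The norm [n] of that vector decides which:
    for nonzero [n] its multiples by [i] and [j] both have norm [n].  When
    [n = 0], a splitting of the coordinates into two pairs has opposite norms on
    the pairs, so it is enough that one of them be nonzero. *)
Lemma orthogonal_norm_surj4 (F : finFieldType) (a b c e r : F) :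
  odd #|F| -> (2%:R : F) != 0 ->
  exists w0 w1 w2 w3 : F,
    a * w0 + b * w1 + c * w2 + e * w3 = 0 /\
    w0 ^+ 2 + w1 ^+ 2 + w2 ^+ 2 + w3 ^+ 2 = r.
Proof.
move=> oddF two0; pose n := a ^+ 2 + b ^+ 2 + c ^+ 2 + e ^+ 2.
have [n0|n0] := eqVneq n 0; last first.
  (* The combination of the left multiples of a + bi + cj + ek by i and j. *)
  have [s [t <-]] := diag_binary_form_surj r oddF n0 n0.
  exists (- s * b - t * c), (s * a + t * e), (- s * e + t * a), (s * c - t * b).
  by rewrite /n; split; ring.
have compl (m m' : F) : m + m' = n -> m != 0 -> m' != 0.
  by move=> eqn; apply: contraNneq => m'0; rewrite -n0 -eqn m'0 addr0.
have [ab0|ab0] := eqVneq (a ^+ 2 + b ^+ 2) 0; last first.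
  have ce0 : c ^+ 2 + e ^+ 2 != 0 by apply: compl ab0; rewrite /n; ring.
  have [s [t <-]] := diag_binary_form_surj r oddF ab0 ce0.
  by exists (- s * b), (s * a), (- t * e), (t * c); split; ring.
have [ac0|ac0] := eqVneq (a ^+ 2 + c ^+ 2) 0; last first.
  have be0 : b ^+ 2 + e ^+ 2 != 0 by apply: compl ac0; rewrite /n; ring.
  have [s [t <-]] := diag_binary_form_surj r oddF ac0 be0.
  by exists (- s * c), (- t * e), (s * a), (t * b); split; ring.
have [ae0|ae0] := eqVneq (a ^+ 2 + e ^+ 2) 0; last first.
  have bc0 : b ^+ 2 + c ^+ 2 != 0 by apply: compl ae0; rewrite /n; ring.
  have [s [t <-]] := diag_binary_form_surj r oddF ae0 bc0.
  by exists (- s * e), (- t * c), (t * b), (s * a); split; ring.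
(* The three pairs containing a have norm zero: adding them up gives
   2 a^2 + n = 0, and then all coordinates vanish. *)
have a0 : a = 0.
  apply/eqP; rewrite -sqrf_eq0 -(mulrI_eq0 _ (mulfI two0)); apply/eqP.
  transitivity ((a ^+ 2 + b ^+ 2) + (a ^+ 2 + c ^+ 2) + (a ^+ 2 + e ^+ 2) - n).
    by rewrite /n; ring.
  by rewrite ab0 ac0 ae0 n0; ring.
have zero (y : F) : a ^+ 2 + y ^+ 2 = 0 -> y = 0.
  by move/eqP; rewrite a0 expr0n add0r sqrf_eq0 => /eqP.
rewrite a0 (zero b ab0) (zero c ac0) (zero e ae0).
have [s [t <-]] := diag_binary_form_surj r oddF (oner_neq0 F) (oner_neq0 F).
by exists s, t, 0, 0; split; ring.
Qed.

Lemma orthogonal_norm_surj (F : finFieldType) (d : nat) (x : 'rV[F]_d) (r : F) :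
  odd #|F| -> (2%:R : F) != 0 -> (4 <= d)%N ->
  exists2 w : 'rV[F]_d, \sum_(i < d) x ord0 i * w ord0 i = 0 & sqnorm w = r.
Proof.
move=> oddF two0 d_ge4; move: x; rewrite -(subnKC d_ge4).
move: (d - 4)%N => m x.
pose y i := x ord0 (lshift m (inord i : 'I_4)).
have [w0 [w1 [w2 [w3 [orth norm]]]]] :=
  orthogonal_norm_surj4 (y 0%N) (y 1%N) (y 2%N) (y 3%N) r oddF two0.
pose w' : 'rV[F]_4 := \row_i [:: w0; w1; w2; w3]`_i.
have sum4 (G : 'I_4 -> F) :
    \sum_(i < 4) G i = G (inord 0) + G (inord 1) + G (inord 2) + G (inord 3).
  rewrite !big_ord_recr big_ord0 /= add0r.
  by do 3?[congr (_ + _)]; congr G; apply: val_inj; rewrite /= inordK.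
exists (row_mx w' 0).
  rewrite big_split_ord /= [X in _ + X]big1 ?addr0 => [|i _]; last first.
    by rewrite row_mxEr mxE mulr0.
  by rewrite sum4 !row_mxEl !mxE !inordK.
rewrite /sqnorm big_split_ord /= [X in _ + X]big1 ?addr0 => [|i _]; last first.
  by rewrite row_mxEr mxE expr0n.
by rewrite sum4 !row_mxEl !mxE !inordK.
Qed.

Theorem proposition1p9 (p k q : nat) (p_prime : prime p) (p_odd : odd p)
    (k_gt0 : (0 < k)%N) (q_eq : q = (p ^ k)%N)
    (F : finFieldType) (cardF : #|F| = q)
    (d : nat) (d_ge4 : (4 <= d)%N) (x : 'rV[F]_d) :
  sum_of_two_unit_vectors x.
Proof.
have oddF : odd #|F| by rewrite cardF q_eq oddX p_odd orbT.
have charF : p \in [pchar F].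
  by apply: (@card_finPcharP _ _ k) => //; rewrite cardF.
have two0 : (2%:R : F) != 0.
  rewrite -(dvdn_pcharf charF) dvdn_prime2 //.
  by apply: contraL p_odd => /eqP ->.
pose h : F := 2%:R^-1.
have [w orth norm] :=
  orthogonal_norm_surj x (1 - h ^+ 2 * sqnorm x) oddF two0 d_ge4.
have unit_pm (e : F) : e ^+ 2 = 1 -> unit_vector (h *: x + e *: w).
  move=> e1; rewrite /unit_vector /sqnorm.
  transitivity (h ^+ 2 * sqnorm x
    + 2%:R * h * e * (\sum_(i < d) x ord0 i * w ord0 i) + e ^+ 2 * sqnorm w).
    rewrite /sqnorm !mulr_sumr -!big_split /=.
    by apply: eq_bigr => i _; rewrite !mxE; ring.
  by rewrite orth norm e1; ring.
exists (h *: x + 1 *: w), (h *: x + (-1) *: w); split.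
- by apply: unit_pm; rewrite expr1n.
- by apply: unit_pm; rewrite sqrrN expr1n.
rewrite addrACA -!scalerDl subrr scale0r addr0.
by rewrite (_ : h + h = 1) ?scale1r // -mulr2n -mulr_natl /h divff.
Qed.
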